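(* Let $r\ge 2$ and $s\ge 1$ be integers and let $F$ be a graph. When $n$ is sufficiently large, \[ \mathrm{ex}_r\bigl(n,\{\mathrm{Tr}_r(M_{s+1}),\mathrm{Tr}_r(F)\}\bigr)=h_{r-1}(s,F)\cdot n+O_{r,s,v(F)}(1), \] where $O_{r,s,v(F)}(1)$ is a quantity bounded in absolute value by a constant depending only on $r$, $s$ and the number $v(F)$ of vertices of $F$. Moreover, the following construction achieves the asymptotic bound. Let $\mathcal{G}$ be an $(r-1)$-uniform hypergraph with $h_{r-1}(s,F)$ hyperedges, with $\phi(\mathcal{G})\le s$, without isolated vertices, and containing no dominated copy of $(F-I,N(I))$ for any independent set $I$ of $F$. Let $\mathcal{H}$ be the $r$-uniform hypergraph on a set of $n$ vertices containing $V(\mathcal{G})$ whose hyperedges are exactly the sets $\{v\}\cup e$ with $v\notin V(\mathcal{G})$ and $e\in E(\mathcal{G})$. Then $\mathcal{H}$ contains neither $M_{s+1}$ nor $F$ as a trace, and $e(\mathcal{H})=h_{r-1}(s,F)\cdot n+O_{r,s,v(F)}(1)$.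
   Context: All hypergraphs are finite; a hypergraph is $r$-uniform if all hyperedges have size $r$. $e(\mathcal{H})$ is the number of hyperedges. $M_{s+1}$ is the graph (a matching) consisting of $s+1$ pairwise disjoint edges, on $2(s+1)$ vertices. Trace: for a hypergraph $\mathcal{H}$ and $S\subseteq V(\mathcal{H})$, the trace of $\mathcal{H}$ on $S$ is the hypergraph $\mathcal{H}_{|S}$ on $S$ with hyperedge set $\{e\cap S: e\in E(\mathcal{H})\}$. $\mathcal{H}$ contains a graph $F$ as a trace if there is $S\subseteq V(\mathcal{H})$ with $|S|=v(F)$ such that $\mathcal{H}_{|S}$ contains $F$ as a sub-hypergraph. $\mathrm{Tr}_r(F)$ denotes the family of minimal $r$-uniform hypergraphs containing $F$ as a trace; $\mathrm{ex}_r(n,\{\mathrm{Tr}_r(M_{s+1}),\mathrm{Tr}_r(F)\})$ is the maximum number of hyperedges in an $r$-uniform hypergraph on $n$ vertices containing neither $M_{s+1}$ nor $F$ as a trace. Domination: a set $D\subseteq V(\mathcal{H})$ is a dominating set of a uniform hypergraph $\mathcal{H}$ if for every vertex $v\notin D$ there is a hyperedge $e$ with $v\in e$ and $e\setminus\{v\}\subseteq D$. A set of vertices is a dominated set if its complement in $V(\mathcal{H})$ is a dominating set. The dominated number $\phi(\mathcal{H})$ is the maximum size of a dominated set. Dominated copy: given a uniform hypergraph $\mathcal{G}$, a graph $F'$ and $W\subseteq V(F')$, there is a dominated copy of $(F',W)$ in $\mathcal{G}$ if there is a bijection $\tau$ from $V(F')$ to a subset $S\subseteq V(\mathcal{G})$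 such that (1) for every edge $uv\in E(F')$ there is a hyperedge of $\mathcal{G}$ intersecting $S$ in exactly the two vertices $\tau(u),\tau(v)$; and (2) for every $w\in W$ there is a hyperedge of $\mathcal{G}$ intersecting $S$ in exactly the vertex $\tau(w)$. For a set $I$ of vertices of $F$, $N(I)$ is the set of vertices of $F$ adjacent to at least one vertex of $I$, and $F-I$ is the graph obtained from $F$ by deleting $I$. The empty set is an independent set. $h_r(s,F)$ is the maximum number of hyperedges in an $r$-uniform hypergraph $\mathcal{G}$ (on any finite number of vertices) with $\phi(\mathcal{G})\le s$ that contains no dominated copy of $(F-I,N(I))$ for any independent set $I$ of $F$. *)

(* Defs.v *)
From mathcomp Require Import all_boot.

Set Implicit Arguments.
Unset Strict Implicit.
Unset Printing Implicit Defensive.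

(* A hypergraph whose vertex set is the finite type T is given by its set of
   hyperedges; all elements of T are vertices, including the isolated ones. *)
Notation hypergraph T := {set {set T}}.

Section Hypergraph.
Variable T : finType.
Implicit Types (G H : hypergraph T) (S D A : {set T}).

Definition uniform (r : nat) H : bool := [forall e in H, #|e| == r].

Definition no_isolated H : bool := [forall v, exists e in H, v \in e].

Definition trace H S : hypergraph T := [set e :&: S | e in H].

Definition dominating G D : bool :=
  [forall v, (v \notin D) ==>
     [exists e in G, (v \in e) && (e :\ v \subset D)]].

Definition dominated G A : bool := dominating G (~: A).

Definition dominated_number G : nat :=
  \max_(A : {set T} | dominated G A) #|A|.

Variable VF : finType.
Implicit Type F : rel VF.

(* A graph is a symmetric irreflexive relation F on a finite type VF; the
   injection f is the embedding of F in the hypergraph trace H S on S. *)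
Definition has_trace F H : bool :=
  [exists S : {set T}, (#|S| == #|VF|) &&
    [exists f : {ffun VF -> T},
      [&& injectiveb f,
          [forall x, f x \in S]
        & [forall x, forall y, F x y ==> ([set f x; f y] \in trace H S)]]]].

Definition dominated_copy F (W : {set VF}) G : bool :=
  [exists tau : {ffun VF -> T},
    let S := tau @: [set: VF] in
    [&& injectiveb tau,
        [forall x, forall y, F x y ==>
           [exists e in G, e :&: S == [set tau x; tau y]]]
      & [forall w in W, exists e in G, e :&: S == [set tau w]]]].

End Hypergraph.

Section Graph.
Variable VF : finType.
Implicit Types (F : rel VF) (I : {set VF}).

Definition independent F I : bool :=
  [forall x in I, forall y in I, ~~ F x y].

Definition neighbours F I : {set VF} := [set y | [exists x in I, F x y]].

Definition delete F I : rel {x : VF | x \notin I} :=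
  fun x y => F (val x) (val y).

(* N(I) seen inside F - I; nothing is lost when I is independent, as N(I) is
   then disjoint from I. *)
Definition neighbours_in_delete F I : {set {x : VF | x \notin I}} :=
  [set x | val x \in neighbours F I].

Definition no_dominated_copy F (T : finType) (G : hypergraph T) : Prop :=
  forall I : {set VF}, independent F I ->
    ~~ dominated_copy (@delete F I) (neighbours_in_delete F I) G.

Definition h_admissible (k s : nat) F (T : finType) (G : hypergraph T) : Prop :=
  [/\ uniform k G, dominated_number G <= s & no_dominated_copy F G].

(* h = h_k(s, F).  The maximum over an empty family is taken to be 0, here and
   in ex_trace; this occurs only if F has no edge, since I = V(F) is then
   independent and (F - I, N(I)) is the empty pair. *)
Definition is_h (k s : nat) F (h : nat) : Prop :=
  (forall (T : finType) (G : hypergraph T), h_admissible k s F G -> #|G| <= h)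
  /\ (h = 0 \/
      exists (T : finType) (G : hypergraph T), h_admissible k s F G /\ #|G| = h).

End Graph.

(* The matching M_m: the edges are the pairs {(i, false), (i, true)}. *)
Definition matching (m : nat) : rel ('I_m * bool) :=
  fun x y => (x.1 == y.1) && (x.2 != y.2).

(* ex_r(n, {Tr_r(F1), Tr_r(F2)}) *)
Definition ex_trace (r n : nat) (V1 : finType) (F1 : rel V1)
    (V2 : finType) (F2 : rel V2) : nat :=
  \max_(H : hypergraph 'I_n |
         [&& uniform r H, ~~ has_trace F1 H & ~~ has_trace F2 H]) #|H|.

(* The hypergraph on U with hyperedges {v} U e, for v outside V(G) and e in G,
   where V(G) = T is identified with a subset of U along f. *)
Definition construction (T U : finType) (f : T -> U) (G : hypergraph T) :
    hypergraph U :=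
  [set v |: [set f x | x in e] | v : U in ~: [set f x | x : T],
                                 e : {set T} in G].

Definition within (C a b : nat) : Prop := a <= b + C /\ b <= a + C.

(* Main.v *)
Require Import Defs.
From mathcomp Require Import all_boot zify.
From Stdlib Require Import Classical.

(** Write q = r - 1 and call the _link_ of a q-set g in H the set of vertices v
    with g + v a hyperedge of H.

    Lower bound. In the construction every hyperedge has a single vertex outside
    V(G). Hence each edge of a trace of M_{s+1} has an end in V(G), and these
    ends form a dominated set of size s + 1. In a trace of F, the vertices placed
    outside V(G) form an independent set I, and the rest is a dominated copy of
    (F - I, N(I)). So both traces are excluded, and the number of hyperedges is
    h (n - |V(G)|), where |V(G)| <= q h once G has no isolated vertex.

    Upper bound. Let H contain neither trace and call a q-set _heavy_ if its
    link has at least (s+1)(q+1) vertices. Everything rests on the sunflower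
    lemma ([sunflower]), used twice.
    - A sunflower with s + 1 petals yields a dominated set of size s + 1, one
      vertex per petal ([sunflower_dominated]). The heavy sets have dominated
      number at most s, because a dominated set of s + 1 vertices could be
      matched greedily into the links and become a trace of M_{s+1}
      ([heavy_dominated]). So there are boundedly many heavy sets.
    - Among the hyperedges containing no heavy set there is no large sunflower:
      if the petals are singletons, the core is heavy; if they are larger, two
      vertices in each of s + 1 petals give a trace of M_{s+1}
      ([leq_card_small_codegree]). So there are boundedly many of them.
    Every other hyperedge is g + v with g heavy, so their number is at most the
    sum over v of |type v|, where type v is the set of heavy g whose link
    contains v. There are boundedly many types. Those occurring at no more than
    2 |V(F)| vertices contribute a bounded amount. A type t occurring more often
    is admissible for h: its members share a large common link, from which the
    vertices of I can be supplied to turn a dominated copy of (F - I, N(I)) in t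
    into a trace of F in H ([common_link_no_dominated_copy]). Thus |t| <= h, and
    |H| <= h n + O(1) ([leq_card_trace_free]). *)

(** * Traces and dominated sets as incidence patterns *)

(** Prescribing the intersection of e with the image of f amounts to a pointwise
    condition on the domain of f; this replaces all set computations with traces
    below by incidences. *)
Lemma imset_traceP {J T : finType} {f : J -> T} (X : {set J}) (e : {set T}) :
  injective f ->
  reflect (forall z, (f z \in e) = (z \in X)) (e :&: f @: [set: J] == f @: X).
Proof.
move=> f_inj; apply: (iffP eqP) => [eqX z | memX].
  by rewrite -(mem_imset X z f_inj) -eqX inE imset_f ?inE // andbT.
apply/setP=> v; rewrite inE.
apply/andP/imsetP=> [[ve /imsetP[z _ vz]]|[z zX ->]].
  by exists z; rewrite // -memX -vz.
by rewrite memX zX imset_f.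
Qed.

Lemma imset_set2 {J T : finType} (f : J -> T) (x y : J) :
  f @: [set x; y] = [set f x; f y].
Proof. by rewrite imsetU1 imset_set1. Qed.

Lemma uniformP {T : finType} {r : nat} {H : hypergraph T} :
  reflect (forall e, e \in H -> #|e| = r) (uniform r H).
Proof. by apply: (iffP forall_inP) => unif e /unif /eqP. Qed.

Lemma has_traceP {VF T : finType} (F : rel VF) (H : hypergraph T) :
  has_trace F H <->
  exists2 f : VF -> T, injective f &
    forall x y, F x y ->
      exists2 e, e \in H & forall z, (f z \in e) = (z \in [set x; y]).
Proof.
split=> [/existsP[S /andP[/eqP cardS /existsP[f /and3P[/injectiveP f_inj]]]] |].
  move=> /forallP fS /forallP trf; exists f => // x y Fxy.
  have defS : f @: [set: VF] = S.
    apply/eqP; rewrite eqEcard card_imset // cardsT cardS leqnn andbT.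
    by apply/subsetP=> _ /imsetP[z _ ->].
  have /forallP/(_ y) := trf x; rewrite Fxy => /imsetP[e eH eqe].
  exists e => //; apply/(imset_traceP _ _ f_inj).
  by rewrite defS -eqe imsetU1 imset_set1.
move=> [f f_inj trf]; apply/existsP; exists (f @: [set: VF]).
rewrite card_imset // cardsT eqxx; apply/existsP; exists [ffun x => f x].
apply/and3P; split.
- by apply/injectiveP=> x y; rewrite !ffunE => /f_inj.
- by apply/forallP=> x; rewrite ffunE imset_f.
apply/forallP=> x; apply/forallP=> y; apply/implyP=> /trf[e eH ememb].
apply/imsetP; exists e => //; apply/esym/eqP.
rewrite !ffunE -imset_set2; exact/(imset_traceP _ _ f_inj).
Qed.

Lemma dominated_copyP {VF T : finType} (F : rel VF) (W : {set VF})
    (G : hypergraph T) :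
  dominated_copy F W G <->
  exists2 f : VF -> T, injective f &
    (forall x y, F x y ->
       exists2 e, e \in G & forall z, (f z \in e) = (z \in [set x; y])) /\
    (forall w, w \in W ->
       exists2 e, e \in G & forall z, (f z \in e) = (z == w)).
Proof.
split.
  move=> /existsP[f /and3P[/injectiveP f_inj /forallP edges /forall_inP sgl]].
  exists f => //; split=> [x y Fxy | w /sgl].
    have /forallP/(_ y) := edges x; rewrite Fxy => /exists_inP[e eG eqe].
    exists e => //; apply/(imset_traceP _ _ f_inj).
    by rewrite imsetU1 imset_set1.
  move=> /exists_inP[e eG eqe]; exists e => // z; rewrite -in_set1.
  by move: z; apply/(imset_traceP _ _ f_inj); rewrite imset_set1.
move=> [f f_inj [edges sgl]]; apply/existsP; exists [ffun x => f x].
have -> : [ffun x => f x] @: [set: VF] = f @: [set: VF].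
  by apply: eq_imset => x; rewrite ffunE.
apply/and3P; split.
- by apply/injectiveP=> x y; rewrite !ffunE => /f_inj.
- apply/forallP=> x; apply/forallP=> y; apply/implyP=> /edges[e eG ememb].
  apply/exists_inP; exists e => //.
  by rewrite !ffunE -imset_set2; apply/(imset_traceP _ _ f_inj).
apply/forall_inP=> w /sgl[e eG ememb]; apply/exists_inP; exists e => //.
rewrite ffunE -imset_set1; apply/(imset_traceP _ _ f_inj) => z.
by rewrite inE.
Qed.

(** Once x i != y i, the incidences force all 2m vertices to be distinct, so a
    trace of a matching is just a family of hyperedges with two private vertices
    each, that is, vertices in no other hyperedge of the family. *)
Lemma has_trace_matchingP {T : finType} (m : nat) (H : hypergraph T) :
  has_trace (@matching m) H <->
  exists (x y : 'I_m -> T) (e : 'I_m -> {set T}),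
    [/\ forall i, e i \in H, forall i, x i != y i,
        forall i j, (x j \in e i) = (i == j)
      & forall i j, (y j \in e i) = (i == j)].
Proof.
split=> [/has_traceP[f f_inj edges] | [x [y [e [eH xNy xe ye]]]]].
  have /fin_all_exists2[e eH ememb] : forall i : 'I_m,
      exists2 e, e \in H &
        forall z, (f z \in e) = (z \in [set (i, false); (i, true)]).
    by move=> i; apply: edges; rewrite /matching eqxx.
  exists (fun i => f (i, false)), (fun i => f (i, true)), e.
  split=> // [i|i j|i j]; first by rewrite (inj_eq f_inj) xpair_eqE andbF.
    by rewrite ememb !inE !xpair_eqE eqxx andbT andbF orbF eq_sym.
  by rewrite ememb !inE !xpair_eqE eqxx andbT andbF orFb eq_sym.
pose f (p : 'I_m * bool) := if p.2 then y p.1 else x p.1.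
have fe i p : (f p \in e i) = (i == p.1) by rewrite /f; case: p.2.
apply/has_traceP; exists f => [[i b] [j c] eqf | [i b] [j c]].
  have /eqP ij : i == j by rewrite -[j]/(j, c).1 -fe -eqf fe.
  by case: b c eqf => [] [] //; rewrite /f ij //= => /eqP;
    rewrite ?[y j == x j]eq_sym (negPf (xNy j)).
move=> /andP[/= /eqP<-{j} bNc]; exists (e i) => // -[j d];
  rewrite fe !inE !xpair_eqE /= eq_sym.
by case: eqP => //= _; case: b c d bNc => [] [] [].
Qed.

(** The hyperedge dominating v has all its other vertices outside A, that is, it
    meets A in v only. *)
Lemma dominatedP {T : finType} (G : hypergraph T) (A : {set T}) :
  reflect (forall v, v \in A -> exists2 e, e \in G & e :&: A = [set v])
          (dominated G A).
Proof.
have eqE v (e : {set T}) : v \in A ->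
    (v \in e) && (e :\ v \subset ~: A) = (e :&: A == [set v]).
  move=> vA; apply/andP/eqP=> [[ve /subsetP sub]|eqv].
    apply/setP=> w; rewrite !inE; apply/andP/eqP=> [[we wA]|-> //].
    apply: contraTeq wA => wv; have := sub w; rewrite !inE wv we; exact.
  split; first by have := set11 v; rewrite -eqv inE => /andP[].
  apply/subsetP=> w; rewrite !inE => /andP[wv we].
  by apply: contra wv => wA; rewrite -in_set1 -eqv inE we.
apply: (iffP forallP) => dom v => [vA | ].
  have := dom v; rewrite inE negbK vA => /exists_inP[e eG].
  by rewrite eqE // => /eqP; exists e.
apply/implyP; rewrite inE negbK => vA; have [e eG eqv] := dom v vA.
by apply/exists_inP; exists e; rewrite // eqE // eqv.
Qed.

(** Dominated sets are systems of hyperedges with one private vertex each: the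
    analogue of [has_trace_matchingP] with one vertex per hyperedge. *)
Lemma leq_dominated_numberP {T : finType} (m : nat) (G : hypergraph T) :
  m <= dominated_number G <->
  exists (a : 'I_m -> T) (e : 'I_m -> {set T}),
    (forall i, e i \in G) /\ (forall i j, (a j \in e i) = (i == j)).
Proof.
split=> [le_m | [a [e [eG ae]]]].
  have [A domA le_mA] : exists2 A : {set T}, dominated G A & m <= #|A|.
    have dom0 : dominated G set0 by apply/dominatedP=> v; rewrite inE.
    rewrite /dominated_number (bigmax_eq_arg set0) // in le_m.
    by case: arg_maxnP le_m => // A; exists A.
  pose a (i : 'I_m) := enum_val (widen_ord le_mA i).
  have /fin_all_exists2[e eG eqe] : forall i,
      exists2 e, e \in G & e :&: A = [set a i].
    by move=> i; move/dominatedP: domA; apply; apply: enum_valP.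
  exists a, e; split=> // i j.
  have -> : (a j \in e i) = (a j \in e i :&: A) by rewrite inE enum_valP andbT.
  by rewrite eqe inE (inj_eq enum_val_inj) -!val_eqE /= eq_sym.
have a_inj : injective a.
  by move=> i j eqa; apply/eqP; rewrite -ae -eqa ae.
rewrite -[m]card_ord -cardsT -(card_imset _ a_inj).
apply: (@leq_bigmax_cond _ (dominated G) (fun A : {set T} => #|A|)).
apply/dominatedP=> _ /imsetP[i _ ->]; exists (e i) => //.
apply/eqP; rewrite -imset_set1; apply/(imset_traceP _ _ a_inj) => j.
by rewrite ae inE eq_sym.
Qed.

Lemma has_traceS {VF T : finType} {F : rel VF} {H H' : hypergraph T} :
  H \subset H' -> has_trace F H -> has_trace F H'.
Proof.
move=> /subsetP sub /has_traceP[f f_inj edges]; apply/has_traceP.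
by exists f => // x y /edges[e eH ememb]; exists e; first exact: sub.
Qed.

Lemma dominated_numberS {T : finType} {G G' : hypergraph T} :
  G \subset G' -> dominated_number G <= dominated_number G'.
Proof.
move=> /subsetP sub; apply/leq_dominated_numberP.
have /leq_dominated_numberP[a [e [eG ae]]] := leqnn (dominated_number G).
by exists a, e; split=> // i; apply: sub.
Qed.

(** * Sunflowers *)

Lemma leq_card_bigcup {I T : finType} (P : {pred I}) (A : I -> {set T}) :
  #|\bigcup_(i in P) A i| <= \sum_(i in P) #|A i|.
Proof.
elim/big_rec2: _ => [|i n X _ leX]; first by rewrite cards0.
by rewrite (leq_trans (leq_card_setU _ _)) // leq_add2l.
Qed.

Lemma leq_card_bigcup_const {I T : finType} (P : {pred I}) (A : I -> {set T})
    (m : nat) :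
  (forall i, i \in P -> #|A i| <= m) -> #|\bigcup_(i in P) A i| <= #|P| * m.
Proof.
move=> leA; rewrite -sum_nat_const.
exact: leq_trans (leq_card_bigcup _ _) (leq_sum _ leA).
Qed.

Definition sunflower_bound (p d : nat) : nat := p ^ d * d`!.

Lemma exists_maximal_disjoint {T : finType} {H : hypergraph T} :
  set0 \notin H ->
  exists M : hypergraph T,
    [/\ M \subset H, trivIset M & forall e, e \in H -> e :&: cover M != set0].
Proof.
move=> H0; pose P (M : hypergraph T) := (M \subset H) && trivIset M.
have P0 : P set0.
  by rewrite /P sub0set; apply/trivIsetP=> e e'; rewrite inE.
case: (arg_maxnP (fun M : hypergraph T => #|M|) P0) => M /andP[MH trivM] maxM.
exists M; split=> // e eH; apply/negP=> /eqP e_disj.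
have eNM : e \notin M.
  apply: contra H0 => eM; rewrite -e_disj (setIidPl _) //.
  exact: (bigcup_sup e eM).
suff /maxM : P (e |: M) by rewrite /= cardsU1 eNM ltnn.
rewrite /P subUset sub1set eH MH /=.
apply/trivIsetP=> A B; rewrite !inE.
have disjE C : C \in M -> [disjoint e & C].
  move=> CM; rewrite -setI_eq0 -subset0 -e_disj setIS //.
  exact: (bigcup_sup C CM).
move=> /orP[/eqP->|AM] /orP[/eqP->|BM]; rewrite ?eqxx // => AB.
- exact: disjE.
- by rewrite disjoint_sym disjE.
exact: (trivIsetP trivM).
Qed.

(** Either the maximal disjoint family M has p members, which form a sunflower
    with empty core, or the few vertices of M meet every hyperedge, so that one
    of them lies in many hyperedges; removing it lowers d. *)
Lemma sunflower {T : finType} {p d : nat} {H : hypergraph T} :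
  uniform d H -> sunflower_bound p d < #|H| ->
  exists (C : {set T}) (e : 'I_p -> {set T}),
    [/\ forall i, e i \in H, forall i, C \proper e i
      & forall i j, i != j -> e i :&: e j = C].
Proof.
elim: d H => [|d IHd] H unifH ltH.
  suff /subset_leq_card : H \subset [set set0].
    by rewrite cards1 leqNgt ltH.
  apply/subsetP=> e /(uniformP unifH)/eqP; rewrite cards_eq0 inE.
  exact.
have H0 : set0 \notin H.
  by apply/negP=> /(uniformP unifH); rewrite cards0.
have [M [MH trivM meetM]] := exists_maximal_disjoint H0.
have [le_pM | lt_Mp] := leqP p #|M|.
  pose e (i : 'I_p) := enum_val (widen_ord le_pM i).
  have eM i : e i \in M by apply: enum_valP.
  exists set0, e; split=> [i | i | i j iNj].
  - exact: (subsetP MH).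
  - by rewrite proper0; apply: contraNneq H0 => <-; apply: (subsetP MH).
  apply/eqP; rewrite setI_eq0; apply: (trivIsetP trivM) => //.
  by rewrite (inj_eq enum_val_inj) -val_eqE.
have cardM : #|cover M| <= p * d.+1.
  apply: leq_trans (_ : #|M| * d.+1 <= _); last by rewrite leq_mul2r ltnW.
  apply: leq_card_bigcup_const => e eM.
  by rewrite (uniformP unifH) ?(subsetP MH).
pose star x := [set e in H | x \in e].
have [x xM lt_star] : exists2 x, x \in cover M &
    sunflower_bound p d < #|star x|.
  apply/exists_inP; apply: contraLR ltH => /exists_inPn small.
  have subH : H \subset \bigcup_(x in cover M) star x.
    apply/subsetP=> e eH; have /set0Pn[x] := meetM e eH.
    by rewrite inE => /andP[xe xM]; apply/bigcupP; exists x; rewrite // inE eH.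
  rewrite -leqNgt; apply: leq_trans (subset_leq_card subH) _.
  apply: leq_trans (leq_card_bigcup_const _ _ (sunflower_bound p d) _) _.
    by move=> x xM; rewrite leqNgt small.
  apply: leq_trans (leq_mul cardM (leqnn _)) _.
  by rewrite /sunflower_bound expnS factS; lia.
pose L := [set e :\ x | e in star x].
have unifL : uniform d L.
  apply/uniformP=> g /imsetP[e]; rewrite inE => /andP[eH xe] ->{g}.
  by have := cardsD1 x e; rewrite xe (uniformP unifH) // => -[].
have cardL : #|L| = #|star x|.
  apply: card_in_imset => e e'; rewrite !inE => /andP[_ xe] /andP[_ xe'] eqe.
  by rewrite -(setD1K xe) eqe setD1K.
have [|C [e [eL Ce eC]]] := IHd L unifL; first by rewrite cardL.
have xNe i : x \notin e i.
  by have /imsetP[e' _ ->] := eL i; rewrite !inE eqxx.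
exists (x |: C), (fun i => x |: e i); split=> [i | i | i j iNj].
- have /imsetP[e'] := eL i; rewrite inE => /andP[eH xe] ->.
  by rewrite setD1K.
- have /properP[sub [y ye yC]] := Ce i; apply/properP.
  split; first exact: setUS.
  exists y; rewrite !inE ?ye ?orbT // negb_or yC andbT.
  by apply: contraNneq (xNe i) => <-.
by rewrite -setUIr eC.
Qed.

(** A vertex of a petal lies in no other member of the sunflower. *)
Lemma sunflower_dominated {T : finType} {m d : nat} {G : hypergraph T} :
  uniform d G -> sunflower_bound m d < #|G| -> m <= dominated_number G.
Proof.
move=> unifG /(sunflower unifG)[C [e [eG Ce eC]]].
have /fin_all_exists2[a ae aC] : forall i, exists2 x, x \in e i & x \notin C.
  by move=> i; have /properP[_ []] := Ce i => x; exists x.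
apply/leq_dominated_numberP; exists a, e; split=> // i j.
have [<- | iNj] := eqVneq i j; first by rewrite ae.
by apply: contraNF (aC j) => aei; rewrite -(eC i j iNj) inE aei ae.
Qed.

Definition link {T : finType} (H : hypergraph T) (g : {set T}) : {set T} :=
  [set v | (v \notin g) && (v |: g \in H)].

(** In a sunflower with p petals, the petals have equal sizes. If they are
    singletons, all of them lie in the link of the core. Otherwise two vertices
    from each petal are private to it. *)
Lemma leq_card_small_codegree {T : finType} (m p q : nat) (H : hypergraph T) :
  uniform q.+1 H -> m <= p ->
  (forall g : {set T}, #|g| = q -> #|link H g| < p) ->
  ~~ has_trace (@matching m) H ->
  #|H| <= sunflower_bound p q.+1.
Proof.
move=> unifH le_mp small; apply: contraR; rewrite -ltnNge.
move=> /(sunflower unifH)[C [e [eH Ce eC]]].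
have mem_e i j x : x \notin C -> x \in e j -> (x \in e i) = (i == j).
  move=> xC xe; have [-> // | iNj] := eqVneq i j.
  by apply: contraNF xC => xei; rewrite -(eC i j iNj) inE xei xe.
have cardD i : #|C| + #|e i :\: C| = q.+1.
  rewrite -(uniformP unifH _ (eH i)) -(cardsID C (e i)).
  by rewrite (setIidPr (proper_sub (Ce i))).
have petal (i : 'I_p) : 1 < #|e i :\: C|.
  rewrite ltnNge; apply/negP=> petal_le1.
  have petal1 j : #|e j :\: C| = 1.
    have := proper_card (Ce j); rewrite (uniformP unifH _ (eH j)).
    by have := cardD j; have := cardD i; lia.
  have /small : #|C| = q.
    by have := cardD i; rewrite petal1 addn1 => -[].
  have /fin_all_exists[v eqv] : forall j, exists v, e j :\: C = [set v].
    by move=> j; apply/cards1P/eqP.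
  have vP j : v j \in e j :\: C by rewrite eqv inE.
  rewrite ltnNge => /negP[].
  rewrite -[p]card_ord -(card_codom (f := v)); last first.
    move=> j j' eqv'; have /setDP[vej vC] := vP j; have /setDP[vej' _] := vP j'.
    by apply/eqP; rewrite -(mem_e j j' (v j')) // -eqv'.
  apply/subset_leq_card/subsetP=> _ /codomP[j ->].
  have /setDP[vej vC] := vP j; rewrite inE vC.
  by rewrite /= setUC -eqv -{1}(setIidPr (proper_sub (Ce j))) setID eH.
have /fin_all_exists[x /fin_all_exists[y xyP]] : forall i : 'I_p,
    exists x y : T, [/\ x \in e i :\: C, y \in e i :\: C & x != y].
  by move=> i; have /card_gt1P[u [v [? ? ?]]] := petal i; exists u, v.
pose w := widen_ord le_mp.
apply/has_trace_matchingP; exists (x \o w), (y \o w), (e \o w).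
have wE i j : (w i == w j) = (i == j) by rewrite -!val_eqE.
split=> [i|i|i j|i j] //=; first by have [_ _] := xyP (w i).
  by have [/setDP[xe xC] _ _] := xyP (w j); rewrite (mem_e _ _ _ xC xe).
by have [_ /setDP[ye yC] _] := xyP (w j); rewrite (mem_e _ _ _ yC ye).
Qed.

(** * Heavy sets *)

Lemma greedy_representatives {J T : finType} (B : J -> {set T}) (X : {set T}) :
  (forall j, #|X| + #|J| <= #|B j|) ->
  exists2 w : J -> T, injective w & forall j, w j \in B j :\: X.
Proof.
move=> largeB.
suff [w w_inj wB] : exists2 w : J -> T,
    {in enum J &, injective w} & {in enum J, forall j, w j \in B j :\: X}.
  by exists w => [i j|j]; [apply: w_inj|apply: wB]; rewrite mem_enum.
have /fin_all_exists[w0 _] : forall j, exists x, x \in B j.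
  move=> j; apply/set0Pn; rewrite -card_gt0; apply: leq_trans (largeB j).
  by rewrite addn_gt0 orbC; apply/orP; left; apply/card_gt0P; exists j.
have : #|X| + size (enum J) <= #|X| + #|J| by rewrite -cardE.
elim: (enum J) (enum_uniq J) => [|j s IHs] /=.
  by move=> _ _; exists w0.
move=> /andP[jNs uniq_s] le_s.
have [|w w_inj wB] := IHs uniq_s.
  by apply: leq_trans le_s; rewrite leq_add2l.
have /subsetPn[v vB vN] : ~~ (B j \subset X :|: [set w i | i in s]).
  apply/negP=> /subset_leq_card; apply/negP; rewrite -ltnNge.
  apply: leq_trans (largeB j); apply: leq_ltn_trans (leq_card_setU _ _) _.
  apply: leq_trans le_s; rewrite ltn_add2l ltnS.
  exact: leq_trans (leq_imset_card _ _) (card_size s).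
move: vN; rewrite inE negb_or => /andP[vX vw].
have vNw i : i \in s -> v != w i.
  by move=> si; apply: contraNneq vw => ->; apply: imset_f.
have eqF i : i \in s -> (i == j) = false.
  by move=> si; apply: contraNF jNs => /eqP<-.
exists (fun i => if i == j then v else w i).
  move=> i i'; rewrite !inE => /predU1P[->|si] /predU1P[->|si'] //.
  - by rewrite eqxx eqF // => /eqP; rewrite (negPf (vNw _ _)).
  - by rewrite eqxx eqF // => /esym/eqP; rewrite (negPf (vNw _ _)).
  by rewrite !eqF //; apply: w_inj.
move=> i; rewrite inE => /predU1P[->|si]; first by rewrite eqxx inE vX.
by rewrite eqF // wB.
Qed.

(** The threshold leaves room to choose, for each of m heavy sets, a vertex of its
    link outside all of them (at most m * q vertices) and different from the m - 1
    vertices chosen for the others. *)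
Definition heavy {T : finType} (m q : nat) (H : hypergraph T) : hypergraph T :=
  [set g : {set T} | (#|g| == q) && (m * q.+1 <= #|link H g|)].

(** Adding to each heavy set a greedily chosen vertex of its link gives every
    hyperedge of a dominating system a second private vertex. *)
Lemma heavy_dominated {T : finType} (m q : nat) (H : hypergraph T) :
  ~~ has_trace (@matching m) H -> dominated_number (heavy m q H) < m.
Proof.
apply: contraR; rewrite -leqNgt => /leq_dominated_numberP[a [e [eW ae]]].
have cardX : #|\bigcup_i e i| <= m * q.
  have := leq_card_bigcup_const predT e q; rewrite card_ord; apply=> i _.
  by have := eW i; rewrite inE => /andP[/eqP->].
have [i | w w_inj wP] :=
    greedy_representatives (fun i => link H (e i)) (\bigcup_i e i).
  have := eW i; rewrite inE => /andP[_]; apply: leq_trans.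
  by rewrite card_ord mulnS addnC leq_add2l.
have wNe i j : w i \notin e j.
  have /setDP[_] := wP i; apply: contra => wie.
  by apply/bigcupP; exists j.
apply/has_trace_matchingP; exists a, w, (fun i => w i |: e i).
split=> [i | i | i j | i j].
- by have /setDP[] := wP i; rewrite inE => /andP[].
- by apply: contraNneq (wNe i i) => <-; rewrite ae.
- rewrite !inE ae; case: eqP => //= eqaw.
  by have := wNe i j; rewrite -eqaw ae eqxx.
by rewrite !inE (negPf (wNe _ _)) orbF (inj_eq w_inj) eq_sym.
Qed.

(** A dominated copy of (F - I, N(I)) in t extends to a trace of F in H: the
    vertices of I are sent into the common link B, a hyperedge realising w in N(I)
    as a singleton is completed by the image of any neighbour of w in I, and a
    hyperedge realising an edge of F - I is completed by one vertex of B outside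
    the trace. The size of B allows avoiding at most |V(F)| vertices already in
    the copy while choosing |V(F)| + 1 new ones. *)
Lemma common_link_no_dominated_copy {VF T : finType} (F : rel VF)
    (H t : hypergraph T) (B : {set T}) :
  symmetric F -> ~~ has_trace F H ->
  (forall g, g \in t -> B \subset link H g) -> 2 * #|VF| < #|B| ->
  no_dominated_copy F t.
Proof.
move=> symF noF Blink largeB I indI; apply: contra noF.
move=> /dominated_copyP[tau tau_inj [edges sgl]].
(* [w (Some x)] is the image reserved for x and [w None] the vertex used to
   complete the edges of F - I. *)
pose X := codom tau.
have [_ | w w_inj wP] :=
    greedy_representatives (fun _ : option VF => B) [set x in X].
  rewrite cardsE card_codom // card_option; apply: leq_trans largeB.
  by rewrite card_sig addnS ltnS mul2n -addnn leq_add2r max_card.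
have wB x : w x \in B by have /setDP[] := wP x.
have wNtau x u : (w x == tau u) = false.
  have /setDP[_] := wP x; rewrite inE; apply: contraNF => /eqP->.
  exact: codom_f.
have wNt x g : g \in t -> w x \notin g.
  by move=> /Blink/subsetP/(_ _ (wB x)); rewrite inE => /andP[].
have wH x g : g \in t -> w x |: g \in H.
  by move=> /Blink/subsetP/(_ _ (wB x)); rewrite inE => /andP[].
pose f x := if insub x is Some u then tau u else w (Some x).
have fI x : x \in I -> f x = w (Some x).
  by move=> xI; rewrite /f insubN ?negbK.
have fNI u : f (val u) = tau u by rewrite /f valK.
have fP x : (x \in I /\ f x = w (Some x)) \/
            (exists u : {x | x \notin I}, x = val u).
  have [xI | xNI] := boolP (x \in I); first by left; rewrite fI.
  by right; exists (Sub x xNI); rewrite SubK.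
have f_inj : injective f.
  move=> x y; have [[xI ->]|[u ->]] := fP x; have [[yI ->]|[v ->]] := fP y.
  - by move=> /w_inj[].
  - by rewrite fNI => /eqP; rewrite wNtau.
  - by rewrite fNI => /esym/eqP; rewrite wNtau.
  by rewrite !fNI => /tau_inj->.
have mixed x (v : {x | x \notin I}) : x \in I -> F x (val v) ->
    exists2 e, e \in H & forall z, (f z \in e) = (z \in [set x; val v]).
  move=> xI Fxv; have [|g gt gmemb] := sgl v.
    by rewrite !inE; apply/exists_inP; exists x.
  exists (w (Some x) |: g); first exact: wH.
  move=> z; have [[zI ->]|[u ->]] := fP z; rewrite !inE.
    rewrite (inj_eq w_inj) (negPf (wNt _ _ gt)) orbF.
    have -> : (Some z == Some x) = (z == x) by [].
    by case: (z =P val v) zI (valP v) => [-> ->|]; rewrite ?orbF.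
  rewrite fNI gmemb eq_sym wNtau (inj_eq val_inj).
  by case: (val u =P x) xI (valP u) => [-> ->|].
apply/has_traceP; exists f => // x y.
have [[xI _]|[u ->]] := fP x; have [[yI _]|[v ->]] := fP y => Fxy.
- by have /forall_inP/(_ x xI)/forall_inP/(_ y yI) := indI; rewrite Fxy.
- exact: mixed.
- by rewrite setUC; apply: mixed; rewrite // symF.
have [g gt gmemb] := edges u v Fxy.
exists (w None |: g); first exact: wH.
move=> z; have [[zI ->]|[u' ->]] := fP z; rewrite !inE.
  rewrite (inj_eq w_inj) (negPf (wNt _ _ gt)) /=.
  case: (z =P val u) zI (valP u) => [-> ->|] //.
  by case: (z =P val v) (valP v) => [-> /negPf->|].
by rewrite fNI gmemb eq_sym wNtau !inE !(inj_eq val_inj).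
Qed.

(** * The upper bound *)

(** With N bounding the number of heavy sets, the first term counts the pairs
    (v, g) with g in the type of v, for the rare types: at most 2 ^ N types, each
    at no more than 2 * k vertices and of size at most N. The second term bounds
    the hyperedges containing no heavy set. *)
Definition upper_error (q s k : nat) : nat :=
  2 ^ sunflower_bound s.+1 q * (2 * k) * sunflower_bound s.+1 q
  + sunflower_bound (s.+1 * q.+1) q.+1.

(** A hyperedge containing a heavy set g is g + v with g in the type of v, so the
    types are summed over the vertices: frequent types have at most h members,
    and rare types occur at boundedly many vertices. *)
Lemma leq_card_trace_free {VF T : finType} (F : rel VF) (q s h : nat)
    (H : hypergraph T) :
  symmetric F -> uniform q.+1 H ->
  ~~ has_trace (@matching s.+1) H -> ~~ has_trace F H ->
  (forall G : hypergraph T, h_admissible q s F G -> #|G| <= h) ->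
  #|H| <= h * #|T| + upper_error q s #|VF|.
Proof.
move=> symF unifH noM noF maxh.
set W := heavy s.+1 q H; set N := sunflower_bound s.+1 q; set k := #|VF|.
have domW : dominated_number W <= s by rewrite -ltnS heavy_dominated.
have unifW : uniform q W.
  by apply/uniformP=> g; rewrite inE => /andP[/eqP].
have cardW : #|W| <= N.
  rewrite leqNgt; apply/negP=> /(sunflower_dominated unifW).
  by rewrite ltnNge domW.
pose light := [set e in H | [forall g in W, ~~ (g \subset e)]].
pose type v := [set g in W | v \in link H g].
pose fiber t := [set v | type v == t].
have card_light : #|light| <= sunflower_bound (s.+1 * q.+1) q.+1.
  have subH : light \subset H by apply/subsetP=> e; rewrite inE => /andP[].
  apply: (leq_card_small_codegree s.+1).
  - by apply/uniformP=> e /(subsetP subH); apply: uniformP.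
  - by rewrite leq_pmulr.
  - move=> g cardg; rewrite ltnNge; apply/negP=> large.
    have /card_gt0P[v] : 0 < #|link light g| by apply: leq_trans large.
    rewrite !inE => /and3P[_ _ /forall_inP/(_ g)]; rewrite subsetUr.
    suff -> : g \in W by move/(_ isT).
    rewrite inE cardg eqxx; apply: leq_trans large _.
    apply/subset_leq_card/subsetP=> u; rewrite !inE.
    by move=> /and3P[-> ->].
  by apply: contra noM; apply: has_traceS.
have card_typed : #|H :\: light| <= \sum_v #|type v|.
  suff /subset_leq_card/leq_trans : H :\: light \subset
      \bigcup_v [set v |: g | g in type v].
    apply; apply: leq_trans (leq_card_bigcup _ _) _.
    by apply: leq_sum => v _; apply: leq_imset_card.
  apply/subsetP=> e /setDP[eH]; rewrite inE eH negb_forall_in.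
  move=> /exists_inP[g gW]; rewrite negbK => ge.
  have : #|e :\: g| = 1.
    have := cardsID g e; rewrite (setIidPr ge) (uniformP unifH _ eH).
    by rewrite (uniformP unifW _ gW) -addn1 => /addnI.
  move=> /eqP/cards1P[v eqv].
  have defe : e = v |: g by rewrite setUC -eqv -{1}(setIidPr ge) setID.
  have vg : v \notin g by have := set11 v; rewrite -eqv => /setDP[].
  apply/bigcupP; exists v => //; apply/imsetP; exists g => //.
  by rewrite inE gW inE vg -defe eH.
pose bad := [set v | #|fiber (type v)| <= 2 * k].
have card_type v : #|type v| <= h + (v \in bad) * N.
  have subW : type v \subset W by apply/subsetP=> g; rewrite inE => /andP[].
  (* A frequent type is admissible; a rare one is only bounded by N. *)
  rewrite inE.
  have [_ | large] := leqP #|fiber (type v)| (2 * k).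
    rewrite /= mul1n; apply: leq_trans (leq_addl _ _).
    exact: leq_trans (subset_leq_card subW) cardW.
  rewrite /= mul0n addn0; apply: maxh; split.
  - by apply/uniformP=> g /(subsetP subW); apply: uniformP.
  - exact: leq_trans (dominated_numberS subW) domW.
  apply: (common_link_no_dominated_copy _ H _ (fiber (type v))) => // g gv.
  apply/subsetP=> u; rewrite inE => /eqP eqt.
  by move: gv; rewrite -eqt inE => /andP[].
have card_bad : #|bad| <= 2 ^ N * (2 * k).
  pose small := [set t in powerset W | #|fiber t| <= 2 * k].
  have sub : bad \subset \bigcup_(t in small) fiber t.
    apply/subsetP=> v; rewrite inE => small_v; apply/bigcupP.
    exists (type v); last by rewrite inE.
    rewrite inE powersetE small_v andbT.
    by apply/subsetP=> g; rewrite inE => /andP[].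
  apply: leq_trans (subset_leq_card sub) _.
  apply: leq_trans (leq_card_bigcup_const _ _ (2 * k) _) _.
    by move=> t; rewrite inE => /andP[].
  rewrite leq_mul2r; apply/orP; right.
  apply: leq_trans (leq_pexp2l _ cardW); rewrite // -card_powerset.
  by apply/subset_leq_card/subsetP=> t; rewrite inE => /andP[].
have sum_type : \sum_v #|type v| <= h * #|T| + 2 ^ N * (2 * k) * N.
  apply: leq_trans (leq_sum _ (fun v _ => card_type v)) _.
  rewrite big_split sum_nat_const -big_distrl /= mulnC leq_add //.
  have -> : \sum_v (v \in bad) = #|bad|.
    rewrite -sum1_card [RHS]big_mkcond.
    by apply: eq_bigr => v _; case: (v \in bad).
  by rewrite leq_mul2r card_bad orbT.
rewrite -(cardsID light H) /upper_error -/N -/k addnA addnC leq_add //.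
  exact: leq_trans card_typed sum_type.
by apply: leq_trans card_light; rewrite subset_leq_card // subsetIr.
Qed.

(** * The construction *)

Lemma construction_memP {T U : finType} {f : T -> U} {G : hypergraph T}
    {e : {set U}} :
  injective f -> e \in construction f G ->
  exists v g, [/\ g \in G, e = v |: f @: g, forall x, f x != v
                & forall x, (f x \in e) = (x \in g)].
Proof.
move=> f_inj /imset2P[v g]; rewrite inE => vN gG ->; exists v, g.
have fNv x : f x != v by apply: contraNneq vN => <-; apply: imset_f.
by split=> // x; rewrite !inE (negPf (fNv x)) mem_imset.
Qed.

Lemma uniform_construction {T U : finType} {f : T -> U} {q : nat}
    {G : hypergraph T} :
  injective f -> uniform q G -> uniform q.+1 (construction f G).
Proof.
move=> f_inj unifG; apply/uniformP=> e /(construction_memP f_inj).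
move=> [v [g [gG -> fNv _]]]; rewrite cardsU1 card_imset //.
rewrite (uniformP unifG) // (_ : v \notin _) //.
by apply/imsetP=> -[x _ eqv]; have := fNv x; rewrite eqv eqxx.
Qed.

Lemma card_construction {T U : finType} (f : T -> U) (G : hypergraph T) :
  injective f -> #|construction f G| = (#|U| - #|T|) * #|G|.
Proof.
move=> f_inj; rewrite /construction curry_imset2X card_in_imset.
  by rewrite cardsX cardsCs setCK card_imset.
move=> [v g] [v' g']; rewrite !inE /= => /andP[vN _] /andP[v'N _] eqe.
have out (w : U) (x : T) : w \notin [set f x | x : T] -> (f x == w) = false.
  by move=> wN; apply: contraNF wN => /eqP<-; apply: imset_f.
have eqg : g = g'.
  apply/setP=> x; have := congr1 (fun A : {set U} => f x \in A) eqe.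
  by rewrite !inE !out // !mem_imset.
rewrite -eqg in eqe; rewrite -eqg; congr (_, _); apply/eqP.
have := setU11 v (f @: g); rewrite [_ |: _]eqe inE in_set1.
case/orP=> // /imsetP[x _ eqv]; case/imsetP: vN.
by exists x.
Qed.

(** Of the two private vertices of a hyperedge v + g at least one differs from v,
    and it is then private to g. *)
Lemma construction_matching {T U : finType} {f : T -> U} {m : nat}
    {G : hypergraph T} :
  injective f -> has_trace (@matching m) (construction f G) ->
  m <= dominated_number G.
Proof.
move=> f_inj /has_trace_matchingP[x [y [e [eH xNy xe ye]]]].
have /fin_all_exists[a /fin_all_exists[g agP]] : forall i, exists a g,
    [/\ g \in G, f a = x i \/ f a = y i & forall t, (f t \in e i) = (t \in g)].
  move=> i; have [v [g [gG eqe _ fe]]] := construction_memP f_inj (eH i).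
  have [xv | xNv] := eqVneq (x i) v.
    have := ye i i; rewrite eqxx {1}eqe inE in_set1 -xv eq_sym (negPf (xNy i)).
    by move=> /imsetP[a _ ->]; exists a, g; split=> //; right.
  have := xe i i; rewrite eqxx {1}eqe inE in_set1 (negPf xNv).
  by move=> /imsetP[a _ ->]; exists a, g; split=> //; left.
apply/leq_dominated_numberP; exists a, g; split=> [i | i j].
  by have [] := agP i.
have [_ _ <-] := agP i.
by have [_ [->|->] _] := agP j.
Qed.

(** The vertices of F placed outside V(G) are independent, since a hyperedge has
    only one such vertex; deleting the outer vertex from the hyperedges realising
    the other edges leaves a dominated copy. *)
Lemma construction_trace_free {VF T U : finType} {F : rel VF} {f : T -> U}
    {G : hypergraph T} :
  irreflexive F -> injective f -> no_dominated_copy F G ->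
  ~~ has_trace F (construction f G).
Proof.
move=> irrF f_inj noG; apply/negP=> /has_traceP[phi phi_inj edges].
pose I := [set x | phi x \notin codom f].
have indI : independent F I.
  apply/forall_inP=> x; rewrite inE => xI; apply/forall_inP=> y.
  rewrite inE => yI; apply/negP=> Fxy; have [e eH ememb] := edges x y Fxy.
  have [v [g [_ eqe _ _]]] := construction_memP f_inj eH.
  have eqv z : z \in [set x; y] -> phi z \notin codom f -> phi z = v.
    rewrite -ememb eqe inE in_set1 => /orP[/eqP // | /imsetP[t _ ->]].
    by rewrite codom_f.
  have /phi_inj eqxy : phi x = phi y.
    by rewrite (eqv _ (set21 x y) xI) (eqv _ (set22 x y) yI).
  by rewrite eqxy irrF in Fxy.
have /fin_all_exists[tau tauE] : forall u : {x | x \notin I},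
    exists t, f t = phi (val u).
  move=> u; have := valP u; rewrite inE negbK => /codomP[t ->].
  by exists t.
have /negP[] := noG I indI; apply/dominated_copyP; exists tau.
  by move=> u v eqt; apply/val_inj/phi_inj; rewrite -!tauE eqt.
split=> [u v Fuv | w].
  have [e eH ememb] := edges _ _ Fuv.
  have [_ [g [gG _ _ fe]]] := construction_memP f_inj eH.
  by exists g => // z; rewrite -fe tauE ememb !inE !(inj_eq val_inj).
rewrite !inE => /exists_inP[x xI Fxw]; have [e eH ememb] := edges _ _ Fxw.
have [_ [g [gG _ _ fe]]] := construction_memP f_inj eH.
exists g => // z; rewrite -fe tauE ememb !inE (inj_eq val_inj).
by case: (val z =P x) xI (valP z) => [-> ->|].
Qed.

(** * The number h *)

(** Dominated sets and dominated copies are carried forward by an injection. *)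
Lemma h_admissible_inj {VF T T' : finType} {F : rel VF} {q s : nat}
    {f : T' -> T} {G : hypergraph T'} :
  injective f -> h_admissible q s F [set f @: g | g : {set T'} in G] ->
  h_admissible q s F G.
Proof.
move=> f_inj [unifG domG noG].
have fG g : g \in G -> f @: g \in [set f @: g | g : {set T'} in G].
  by move=> gG; apply: imset_f.
split.
- by apply/uniformP=> g /fG gG; rewrite -(card_imset _ f_inj) (uniformP unifG).
- apply: leq_trans domG; apply/leq_dominated_numberP.
  have /leq_dominated_numberP[a [e [eG ae]]] := leqnn (dominated_number G).
  exists (f \o a), (fun i => f @: e i).
  by split=> [i | i j]; [apply: fG | rewrite /= mem_imset].
move=> I indI; apply: contra (noG I indI).
move=> /dominated_copyP[tau tau_inj [edges sgl]]; apply/dominated_copyP.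
exists (f \o tau); first exact: inj_comp.
split=> [x y /edges[g gG memg] | w /sgl[g gG memg]].
  by exists (f @: g); [apply: fG | move=> z; rewrite /= mem_imset].
by exists (f @: g); [apply: fG | move=> z; rewrite /= mem_imset].
Qed.

Lemma card_cover_uniform {T : finType} {q : nat} {G : hypergraph T} :
  uniform q G -> #|cover G| <= #|G| * q.
Proof.
by move=> unifG; apply: leq_card_bigcup_const => g /(uniformP unifG)->.
Qed.

(** Removing the isolated vertices bounds the number of vertices in terms of the
    number of hyperedges, which keeps the error of the lower bound independent of
    the extremal hypergraph that is chosen. *)
Lemma h_admissible_cover {VF T : finType} {F : rel VF} {q s : nat}
    {G : hypergraph T} :
  h_admissible q s F G ->
  exists (T' : finType) (G' : hypergraph T'),
    [/\ h_admissible q s F G', #|G'| = #|G| & #|T'| <= #|G| * q].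
Proof.
move=> admG; pose V := {x | x \in cover G}.
pose G' : hypergraph V := [set val @^-1: g | g : {set T} in G].
have valK g : g \in G -> val @: (val @^-1: g : {set V}) = g.
  move=> gG; apply/setP=> x; apply/imsetP/idP=> [[u ug ->]|xg].
    by rewrite inE in ug.
  have xV : x \in cover G by apply/bigcupP; exists g.
  by exists (Sub x xV); rewrite ?inE SubK.
have cardG' : #|G'| = #|G|.
  apply: card_in_imset => g g' gG g'G eqg.
  by rewrite -(valK g gG) eqg valK.
exists V, G'; split=> //; last first.
  by rewrite card_sig; have [unifG _ _] := admG; apply: card_cover_uniform.
apply: (h_admissible_inj val_inj).
suff -> : [set val @: g | g : {set V} in G'] = G by [].
rewrite -imset_comp -[RHS]imset_id; apply: eq_in_imset => g gG.
exact: valK.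
Qed.

Lemma card_h_admissible {VF T : finType} {F : rel VF} {q s : nat}
    {G : hypergraph T} :
  h_admissible q s F G -> #|G| <= sunflower_bound s.+1 q.
Proof.
move=> [unifG domG _]; rewrite leqNgt.
by apply/negP=> /(sunflower_dominated unifG); rewrite ltnNge domG.
Qed.

(** Classical because the values attained in the definition of h are described by
    a quantification over all finite types, with no decision procedure at hand. *)
Lemma classical_bounded_max (P : nat -> Prop) (N : nat) :
  P 0 -> (forall m, P m -> m <= N) ->
  exists2 m, P m & forall m', P m' -> m' <= m.
Proof.
move=> P0; elim: N => [|N IHN] leN; first by exists 0.
have [PN | NPN] := classic (P N.+1); first by exists N.+1.
apply: IHN => m Pm; rewrite -ltnS ltn_neqAle leN // andbT.
by apply/eqP=> eqm; rewrite eqm in Pm.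
Qed.

Lemma exists_is_h {VF : finType} (F : rel VF) (q s : nat) :
  exists h, is_h q s F h.
Proof.
pose P m := m = 0 \/
  exists (T : finType) (G : hypergraph T), h_admissible q s F G /\ #|G| = m.
have [||h Ph maxh] := @classical_bounded_max P (sunflower_bound s.+1 q).
- by left.
- by move=> m [-> // | [T [G [admG <-]]]]; exact: card_h_admissible admG.
exists h; split=> // T G admG; apply: maxh.
by right; exists T, G.
Qed.

(** * Both bounds for the extremal number *)

(** The construction misses h hyperedges for each vertex of G. Both h and the
    number of vertices per hyperedge are bounded. *)
Definition construction_error (q s : nat) : nat :=
  sunflower_bound s.+1 q * (sunflower_bound s.+1 q * q).

Lemma construction_spec {VF T U : finType} {F : rel VF} {q s : nat} {f : T -> U}
    {G : hypergraph T} :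
  irreflexive F -> injective f -> h_admissible q s F G ->
  #|T| <= #|G| * q ->
  [/\ uniform q.+1 (construction f G),
      ~~ has_trace (@matching s.+1) (construction f G),
      ~~ has_trace F (construction f G)
    & #|G| * #|U| <= #|construction f G| + construction_error q s].
Proof.
move=> irrF f_inj admG cardT; have [unifG domG noG] := admG; split.
- exact: uniform_construction.
- by apply/negP=> /(construction_matching f_inj); rewrite ltnNge domG.
- exact: construction_trace_free.
have cardG := card_h_admissible admG; rewrite card_construction // mulnC.
rewrite -leq_subLR -mulnBl.
have : #|U| - (#|U| - #|T|) <= #|T| by lia.
move=> /(fun le => leq_trans le cardT) le; rewrite mulnC.
apply: leq_mul => //; apply: leq_trans le _.
by rewrite leq_mul2r cardG orbT.
Qed.

Lemma leq_ex_trace {r n : nat} {V1 V2 : finType} {F1 : rel V1} {F2 : rel V2}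
    {H : hypergraph 'I_n} :
  uniform r H -> ~~ has_trace F1 H -> ~~ has_trace F2 H ->
  #|H| <= ex_trace r n F1 F2.
Proof.
move=> unifH no1 no2.
apply: (@leq_bigmax_cond _ (fun H : hypergraph 'I_n =>
  [&& uniform r H, ~~ has_trace F1 H & ~~ has_trace F2 H]) (fun H => #|H|)).
exact/and3P.
Qed.

Theorem theorem1p6 (r s k : nat) (hr : 2 <= r) (hs : 1 <= s) :
  exists C : nat,
  forall (VF : finType) (F : rel VF),
    symmetric F -> irreflexive F -> #|VF| = k ->
  exists h : nat,
    [/\ is_h r.-1 s F h,
        exists n0 : nat, forall n : nat, n0 <= n ->
          within C (ex_trace r n (@matching s.+1) F) (h * n)
      & forall (T : finType) (G : hypergraph T),
          uniform r.-1 G -> #|G| = h -> dominated_number G <= s ->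
          no_isolated G -> no_dominated_copy F G ->
        forall (n : nat) (U : finType) (f : T -> U),
          #|U| = n -> injective f ->
          let H := construction f G in
          [/\ uniform r H,
              ~~ has_trace (@matching s.+1) H,
              ~~ has_trace F H
            & within C #|H| (h * n)]].
Proof.
case: r hr => [//|q] _ /=.
exists (construction_error q s + upper_error q s k) => VF F symF irrF cardVF.
have [h is_h_h] := exists_is_h F q s; have [maxh attained] := is_h_h.
exists h; split=> //.
  have upper n : ex_trace q.+1 n (@matching s.+1) F <= h * n + upper_error q s k.
    apply/bigmax_leqP=> H /and3P[unifH noM noF].
    by rewrite -[n in h * n]card_ord -cardVF;
      apply: leq_card_trace_free => // G; apply: maxh.
  have [n0 lower] : exists n0, forall n, n0 <= n ->
      h * n <= ex_trace q.+1 n (@matching s.+1) F + construction_error q s.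
    case: attained => [-> | [T0 [G0 [admG0 eqh]]]]; first by exists 0.
    have [T [G [admG eqG cardT]]] := h_admissible_cover admG0.
    exists #|T| => n le_n; pose f (x : T) := widen_ord le_n (enum_rank x).
    have f_inj : injective f by move=> x y [/val_inj/enum_rank_inj].
    rewrite -eqG in cardT eqh.
    have [unifH noM noF] := construction_spec irrF f_inj admG cardT.
    rewrite card_ord eqh => /leq_trans; apply.
    by rewrite leq_add2r leq_ex_trace.
  by exists n0 => n /lower le_n; split; have := upper n; lia.
move=> T G unifG cardG domG isoG noG n U f cardU f_inj.
have admG : h_admissible q s F G by [].
have cardT : #|T| <= #|G| * q.
  apply: leq_trans (card_cover_uniform unifG); rewrite -cardsT.
  apply/subset_leq_card/subsetP=> x _.
  by have /forallP/(_ x)/exists_inP[g gG xg] := isoG; apply/bigcupP; exists g.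
have [unifH noM noF] := construction_spec irrF f_inj admG cardT.
rewrite cardG cardU => lower; split=> //; split; last first.
  by rewrite addnA (leq_trans lower) ?leq_addr.
rewrite card_construction // cardG cardU mulnC.
by rewrite (leq_trans _ (leq_addr _ _)) // leq_mul2l leq_subr orbT.
Qed.
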